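(* Let $S$ be a schema with $d$ attributes and let $r$ be a relation over $S$ with $r = r_1 \cup \ldots \cup r_p$, where $r_i \cap r_j = \emptyset$ for $i \neq j$. Let $u_i = \mathrm{Sky}(r_i)$ for $i = 1,\ldots,p$, and let $u = u_1 \cup \ldots \cup u_p$. For each $i = 1,\ldots,p$, let $pd_i \subseteq u \setminus u_i$ be any subset such that, for all $t \in u_i$, $$t \notin \mathrm{Sky}(r) \implies \exists s \in pd_i \text{ such that } s \prec t.$$ Then $$\mathrm{Sky}(r) = \mathrm{Sky}_{pd_1}(u_1) \cup \ldots \cup \mathrm{Sky}_{pd_p}(u_p).$$
   Context: A schema $S = \{A_1,\ldots,A_d\}$ is a set of attributes. A tuple $t$ over $S$ is a function associating each attribute $A_i \in S$ with a value $t[A_i]$ that is a non-negative real number; a tuple can thus be regarded as a point with $d$ non-negative real coordinates. A relation over $S$ is a set of tuples over $S$. Dominance: for tuples $t, s$ over $S$, $t$ dominates $s$, written $t \prec s$, if $t[A] \leq s[A]$ for every attribute $A \in S$ and there exists an attribute $A' \in S$ with $t[A'] < s[A']$. Skyline: for a relation $r$ over $S$, $\mathrm{Sky}(r) = \{t \in r \mid \nexists s \in r \text{ with } s \prec t\}$. Relative skyline: for relations $r$ and $c$ over $S$, the relative skyline of $r$ with respect to $c$ is $\mathrm{Sky}_c(r) = \{t \in r \mid \nexists s \in c \text{ with } s \prec t\}$. *)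

(* Defs.v *)
From HB Require Import structures.
From mathcomp Require Import all_boot all_order all_algebra.
From mathcomp Require Import boolp classical_sets reals interval_inference.

Set Implicit Arguments.
Unset Strict Implicit.
Unset Printing Implicit Defensive.

Import Order.TTheory GRing.Theory Num.Theory.

Local Open Scope classical_set_scope.
Local Open Scope ring_scope.

(* A schema is the finite type S of its attributes; the name [tuple] is already
   taken by fixed-length sequences. *)
Definition db_tuple (R : realType) (S : finType) : Type := S -> {nonneg R}.

(* Relations may be infinite. *)
Definition relation (R : realType) (S : finType) : Type := set (db_tuple R S).

Definition dominates (R : realType) (S : finType) (t s : db_tuple R S) : Prop :=
  (forall A : S, (t A)%:num <= (s A)%:num) /\
  (exists A : S, (t A)%:num < (s A)%:num).

Definition Sky (R : realType) (S : finType) (r : relation R S) : relation R S :=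
  [set t | r t /\ ~ (exists2 s, r s & dominates s t)].

Definition relSky (R : realType) (S : finType) (c r : relation R S) :
    relation R S :=
  [set t | r t /\ ~ (exists2 s, c s & dominates s t)].

(* Main.v *)
Require Import Defs.
From HB Require Import structures.
From mathcomp Require Import all_boot all_order all_algebra.
From mathcomp Require Import boolp classical_sets reals interval_inference.

Set Implicit Arguments.
Unset Strict Implicit.
Unset Printing Implicit Defensive.

Import Order.TTheory GRing.Theory Num.Theory.

Local Open Scope classical_set_scope.
Local Open Scope ring_scope.

(** Shrinking the set of potential dominators can only enlarge a skyline. Both [r_ i] and [pd i] lie
    inside [r], so a tuple of [r_ i] undominated in [r] survives the local skyline and then the
    filter by [pd i]. Conversely, [hpd] says that [pd i] keeps a dominator for every tuple of [u_ i]
    outside [Sky r], so the filter removes all false candidates. *)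

Theorem proposition2 (R : realType) (d : nat) (S : finType) (hS : #|S| = d)
    (r : relation R S) (p : nat) (r_ : 'I_p -> relation R S)
    (hr : r = \bigcup_(i : 'I_p) r_ i)
    (hdisj : forall i j : 'I_p, i <> j -> r_ i `&` r_ j = set0)
    (u_ : 'I_p -> relation R S) (hu_ : forall i : 'I_p, u_ i = Sky (r_ i))
    (u : relation R S) (hu : u = \bigcup_(i : 'I_p) u_ i)
    (pd : 'I_p -> relation R S)
    (hpd_sub : forall i : 'I_p, pd i `<=` u `\` u_ i)
    (hpd : forall (i : 'I_p) (t : db_tuple R S), u_ i t ->
      ~ Sky r t -> exists2 s, pd i s & dominates s t) :
  Sky r = \bigcup_(i : 'I_p) relSky (pd i) (u_ i).
Proof.
have sub_r i : r_ i `<=` r by rewrite hr => t rit; exists i.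
have pd_r i : pd i `<=` r.
  move=> s /hpd_sub [+ _]; rewrite hu => -[j _].
  by rewrite hu_ => -[/sub_r].
apply/seteqP; split=> t.
- move=> [rt undom_t].
  have [i _ rit] : (\bigcup_(i : 'I_p) r_ i) t by rewrite -hr.
  (* The block containing [t] serves as index; a dominator of [t] in [r_ i] or in [pd i] would also
     be one in [r]. *)
  exists i => //; split.
    rewrite hu_; split=> // -[s /sub_r rs s_t].
    by apply: undom_t; exists s.
  by move=> [s /pd_r rs s_t]; apply: undom_t; exists s.
- move=> [i _ [uit undom_t]].
  (* Negating [Sky r t] as a whole is what lets [hpd] apply; the dominator it yields in [pd i]
     contradicts [undom_t]. *)
  by apply: contrapT => /(hpd i t uit).
Qed.
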